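(* Let $T$ be a finite abelian group and let $b\colon T\times T\to\mathbb{Q}/\mathbb{Z}$ be a symmetric bilinear form. Then $b$ has a tame quadratic enhancement, i.e. there is a function $\psi\colon T\to\mathbb{Q}/\mathbb{Z}$ such that $\psi(ax)=a^2\psi(x)$ for all $a\in\mathbb{Z}$, $x\in T$; $\psi(x+y)-\psi(x)-\psi(y)=b(x,y)$ for all $x,y\in T$; and $\psi(x)=0$ for all $x\in T^\perp$.
   Context: $T^\perp=\{t\in T : b(t,s)=0 \text{ for all } s\in T\}$. *)

(* Defs.v *)
From HB Require Import structures.
From mathcomp Require Import all_boot all_order all_algebra.

Set Implicit Arguments.
Unset Strict Implicit.
Unset Printing Implicit Defensive.

Import GRing.Theory.
Local Open Scope ring_scope.

Definition ratZ : {pred rat} := fun q => q \is a Num.int.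

HB.instance Definition _ := GRing.ZmodClosed.copy ratZ Num.int_num_subdef.

(* The notation {ideal_quot _} only needs an additive subgroup to produce a
   quotient zmodType: no ring structure is put on QmodZ. *)
Definition QmodZ : Type := {ideal_quot ratZ}.

HB.instance Definition _ := ZmodQuotient.on QmodZ.

Section Pairings.
Variable T : finZmodType.
Implicit Types (b : T -> T -> QmodZ) (psi : T -> QmodZ).

Definition symmetric_pairing b := forall x y, b x y = b y x.

(* zmod_morphism is compatibility with subtraction, i.e. additivity; over Z
   this is the same as linearity. *)
Definition bilinear_pairing b :=
  (forall x, zmod_morphism (b x)) /\ (forall y, zmod_morphism (b^~ y)).

Definition perp b : {set T} := [set t | [forall s, b t s == 0]].

Definition tame_quadratic_enhancement b psi :=
  [/\ forall (a : int) x, psi (x *~ a) = psi x *~ (a ^+ 2),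
      forall x y, psi (x + y) - psi x - psi y = b x y
    & forall x, x \in perp b -> psi x = 0].

End Pairings.

(* Main.v *)
Require Import Defs.
From mathcomp Require Import all_boot all_order all_algebra.

(** An enhancement [psi] satisfies [2 psi(x) = b(x, x)], so on [2T + T^perp] it
    has to be [2x + p |-> 2 b(x, x)], and this is indeed well defined and
    quadratic.  Over a subgroup [H] containing [2T], adjoining one element [x]
    outside [H] is unobstructed: since [2x] is in [H] already, any [c] with
    [2c = b(x, x)] can serve as the value at [x], and such a [c] exists because
    [Q/Z] is divisible. *)

Set Implicit Arguments.
Unset Strict Implicit.
Unset Printing Implicit Defensive.

Import GRing.Theory.
Local Open Scope ring_scope.

Lemma QmodZ_halves (u : QmodZ) : exists c, c *+ 2 = u.
Proof.
have [c c2] : exists c : rat, c *+ 2 = repr u.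
  have half (q : rat) : exists c : rat, c *+ 2 = q.
    by exists (q / 2%:R); rewrite -[LHS]mulr_natr mulfVK.
  exact: half.
exists (\pi_QmodZ c)%qT.
by rewrite -[RHS]reprK -c2 mulr2n -(raddfD (\pi_QmodZ)%qT).
Qed.

Section Enhancements.
Variables (T : finZmodType) (A : zmodType) (b : T -> T -> A).
Hypothesis b_sym : forall x y, b x y = b y x.
Hypothesis b_add : forall y, zmod_morphism (b^~ y).

Let b0l y : b 0 y = 0.
Proof. by have := b_add y 0 0; rewrite !subrr. Qed.

Let bNl x y : b (- x) y = - b x y.
Proof. by have := b_add y 0 x; rewrite /= b0l !sub0r. Qed.

Let bDl x y z : b (x + y) z = b x z + b y z.
Proof. by have := b_add z x (- y); rewrite /= bNl !opprK. Qed.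

Let bDr x y z : b z (x + y) = b z x + b z y.
Proof. by rewrite b_sym bDl !(b_sym z). Qed.

Let bMl x y n : b (x *+ n) y = b x y *+ n.
Proof. by elim: n => [|n IHn]; rewrite ?b0l // !mulrS bDl IHn. Qed.

Definition quadratic_on (H : {set T}) (psi : T -> A) :=
  {in H &, forall y z, psi (y + z) = psi y + psi z + b y z}.

(** As [x *+ 2] lies in [H], the union of [H] and [x + H] is closed under addition. The value [c] at
    [x] forces [psi'] on the coset, so only sums of two coset elements, which fall back into [H],
    need a real check. *)
Lemma adjoin_element (H : {set T}) (psi : T -> A) (x : T) (c : A) :
    {in H &, forall y z, y + z \in H} -> (forall y, y *+ 2 \in H) ->
    (forall y, psi (y *+ 2) = b y y *+ 2) -> quadratic_on H psi ->
    x \notin H -> c *+ 2 = b x x ->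
  exists (H' : {set T}) (psi' : T -> A),
    [/\ H \proper H', {in H' &, forall y z, y + z \in H'},
        {in H, psi' =1 psi} & quadratic_on H' psi'].
Proof.
move=> HD H2 psi2 psiD xH c2.
have HN y : y \in H -> - y \in H.
  (* Negatives come from closure under addition because [H] contains all doubles. *)
  move=> yH; have -> : - y = y + (- y) *+ 2 by rewrite mulr2n addrA subrr sub0r.
  exact: HD.
have coset h : h \in H -> (x + h \in H) = false.
  move=> hH; apply: contraNF xH => xhH; rewrite -(addrK h x).
  by rewrite HD ?HN.
pose H' := H :|: [set y | y - x \in H].
have H'P y : y \in H' -> (y \in H) \/ (exists2 h, h \in H & y = x + h).
  rewrite !inE => /orP[yH|yH]; [by left | right].
  by exists (y - x) => //; rewrite addrC subrK.
have H'x h : h \in H -> x + h \in H'.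
  by move=> hH; rewrite !inE addrC addrK hH orbT.
have H'H h : h \in H -> h \in H' by rewrite !inE => ->.
have twice h k : x + h + (x + k) = x *+ 2 + (h + k) by rewrite addrACA mulr2n.
pose psi' y := if y \in H then psi y else psi (y - x) + b (y - x) x + c.
have psi'H h : h \in H -> psi' h = psi h by rewrite /psi' => ->.
have psi'x h : h \in H -> psi' (x + h) = psi h + b h x + c.
  by move=> hH; rewrite /psi' coset // [x + h]addrC addrK.
have psi'D h k : h \in H -> k \in H ->
    psi' (h + (x + k)) = psi' h + psi' (x + k) + b h (x + k).
  move=> hH kH; rewrite addrCA !psi'x ?psi'H ?HD // psiD // bDl bDr.
  by rewrite !addrA [RHS](ACl (1*2*6*5*3*4)%AC).
exists H', psi'; split=> //.
- rewrite properE subsetUl; apply/subsetPn; exists x => //.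
  by rewrite !inE subrr -(mul0rn T 2) H2 orbT.
- move=> y z /H'P[yH|[h hH ->]] /H'P[zH|[k kH ->]].
  + by rewrite H'H ?HD.
  + by rewrite addrCA H'x ?HD.
  + by rewrite -addrA H'x ?HD.
  + by rewrite twice H'H // HD // HD.
move=> y z /H'P[yH|[h hH ->]] /H'P[zH|[k kH ->]].
- by rewrite !psi'H ?psiD ?HD.
- exact: psi'D.
- by rewrite addrC psi'D // b_sym [psi' z + _]addrC.
have hkH := HD h k hH kH.
(* The left side contributes [psi (x *+ 2)], that is [b x x *+ 2]; on the right, one [b x x] comes
   from the pairing and the other is [c *+ 2]. *)
rewrite twice psi'H; last exact: HD.
rewrite !psi'x // psiD ?H2 // psi2 psiD // bMl.
rewrite !bDl !bDr (b_sym x h) (b_sym x k).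
rewrite !mulr2n -{1}c2 mulr2n !addrA.
by rewrite [RHS](ACl (3*6*7*1*4*10*2*5*9*8)%AC).
Qed.

(** Induction on the size of the complement of [H]. The formula for [psi (y *+ 2)] survives each
    step since doubles already lie in [H], where values are kept. *)
Lemma extend_enhancement (H : {set T}) (psi : T -> A) :
    (forall u : A, exists c, c *+ 2 = u) ->
    {in H &, forall y z, y + z \in H} -> (forall y, y *+ 2 \in H) ->
    (forall y, psi (y *+ 2) = b y y *+ 2) -> quadratic_on H psi ->
  exists2 psi', {in H, psi' =1 psi} & quadratic_on setT psi'.
Proof.
move=> halves; have [n] := ubnP #|~: H|; elim: n H psi => // n IHn H psi.
move=> leHn HD H2 psi2 psiD.
have [/eqP HT | [x xH]] := set_0Vmem (~: H).
  by exists psi => //; rewrite -(setCK H) (eqP HT) setC0 in psiD.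
have [c c2] := halves (b x x); rewrite inE in xH.
have [H' [psi' [ltHH' H'D eq_psi psi'D]]] :=
  adjoin_element HD H2 psi2 psiD xH c2.
have sHH' := subsetP (proper_sub ltHH').
have [|||||psi'' eq_psi' psi''D] // := IHn H' psi'.
- rewrite -ltnS; apply: leq_trans leHn; rewrite ltnS.
  by apply: proper_card; rewrite properC.
- by move=> y; apply: sHH'.
- by move=> y; rewrite eq_psi.
by exists psi'' => // y yH; rewrite eq_psi' ?eq_psi ?sHH'.
Qed.

Lemma exists_enhancement_on_double : exists (H : {set T}) (psi : T -> A),
  [/\ {in H &, forall y z, y + z \in H}, forall y, y *+ 2 \in H,
      forall y, psi (y *+ 2) = b y y *+ 2, quadratic_on H psi
    & forall y, (forall s, b y s = 0) -> y \in H /\ psi y = 0].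
Proof.
(* Equivalent to [h - 2x] being in [T^perp]. *)
pose half h x := [forall s, b h s == b x s *+ 2].
have halfP h x : reflect (forall s, b h s = b x s *+ 2) (half h x).
  exact: (iffP eqfunP).
pose H := [set h | [exists x, half h x]].
pose psi h := let x := odflt 0 [pick x | half h x] in b x x *+ 2.
have psiE h x : half h x -> psi h = b x x *+ 2.
  rewrite /psi; case: pickP => [y|/(_ x)->//] /= /halfP hy /halfP hx.
  by transitivity (b h y); [rewrite hy | rewrite hx b_sym -hy hx].
have HI h x : half h x -> h \in H.
  by move=> hx; rewrite inE; apply/existsP; exists x.
have halfD h k x y : half h x -> half k y -> half (h + k) (x + y).
  by move=> /halfP hx /halfP ky; apply/halfP => s; rewrite !bDl hx ky mulrnDl.
have half2 y : half (y *+ 2) y by apply/halfP => s; rewrite bMl.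
exists H, psi; split.
- move=> h k; rewrite !inE => /existsP[x hx] /existsP[y ky].
  by apply/existsP; exists (x + y); apply: halfD.
- by move=> y; apply: HI (half2 y).
- by move=> y; apply: psiE.
- move=> h k; rewrite !inE => /existsP[x hx] /existsP[y ky].
  rewrite (psiE _ _ (halfD _ _ _ _ hx ky)) (psiE _ _ hx) (psiE _ _ ky).
  (* Halving both arguments turns b(h,k) into 4b(x,y), the cross term of 2b(x+y,x+y). *)
  rewrite (halfP _ _ hx) b_sym (halfP _ _ ky) -!mulrnDl; congr (_ *+ 2).
  by rewrite bDl !bDr (b_sym x y) mulr2n !addrA [LHS](ACl (1*4*2*3)%AC).
(* Elements of T^perp have 0 as a half, which gives tameness. *)
move=> h h0; have hx : half h 0 by apply/halfP => s; rewrite b0l mul0rn.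
by rewrite (HI _ _ hx) (psiE _ _ hx) b0l mul0rn.
Qed.

(** Comparing the two expressions for psi(2x) gives b(x,x) = 2 psi(x). This makes [psi] even, and
    then n^2 + 1 + 2n = (n+1)^2 drives the induction. *)
Lemma quadratic_homogeneous (psi : T -> A) :
    quadratic_on setT psi -> (forall y, psi (y *+ 2) = b y y *+ 2) ->
  forall (a : int) x, psi (x *~ a) = psi x *~ (a ^+ 2).
Proof.
move=> psiD psi2.
have dbl x : b x x = psi x *+ 2.
  by apply: (addIr (b x x)); rewrite -mulr2n -psi2 !mulr2n psiD ?inE.
have psi0 : psi 0 = 0 by rewrite -(mul0rn T 2) psi2 b0l mul0rn.
have psiN x : psi (- x) = psi x.
  apply: (addrI (psi x)); apply: (addIr (b x (- x))).
  by rewrite -psiD ?inE // subrr psi0 b_sym bNl dbl mulr2n subrr.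
have psiM x n : psi (x *+ n) = psi x *+ (n ^ 2).
  elim: n => [|n IHn]; first by rewrite psi0.
  rewrite mulrSr psiD ?inE // IHn bMl dbl -mulrnA -mulrSr -mulrnDr.
  by rewrite -[n.+1]addn1 sqrnD muln1 -[(n ^ 2).+1]addn1.
move=> [n|n] x.
  by rewrite -pmulrn psiM expr2 -PoszM -pmulrn.
by rewrite NegzE mulrNz psiN sqrrN -pmulrn psiM.
Qed.

End Enhancements.

Theorem theorem1p11 (T : finZmodType) (b : T -> T -> QmodZ)
    (b_sym : symmetric_pairing b) (b_bilin : bilinear_pairing b) :
  exists psi : T -> QmodZ, tame_quadratic_enhancement b psi.
Proof.
have [_ b_add] := b_bilin.
have [H [psi0 [HD H2 psi02 psi0D perp0]]] :=
  exists_enhancement_on_double b_sym b_add.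
have [psi eq_psi psiD] :=
  extend_enhancement b_sym b_add QmodZ_halves HD H2 psi02 psi0D.
exists psi; split.
- by apply: (quadratic_homogeneous b_sym b_add psiD) => y; rewrite eq_psi.
- by move=> x y; rewrite psiD ?inE // -addrA -opprD addrAC subrr add0r.
by move=> x; rewrite inE => /eqfunP/perp0[xH <-]; apply: eq_psi.
Qed.
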